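(* Let $R$ be a ring. A representation $\mathcal{G}=(G_0\to G_1\to G_2\to\cdots)$ of the quiver $A_\infty^+$ by left $R$-modules is an injective object of $(A_\infty^+,R\text{-Mod})$ if and only if each $G_n$ ($n\ge 0$) is an injective left $R$-module and each map $G_n\to G_{n+1}$ is surjective with an injective kernel. That is, $A_\infty^+$ is a source injective representation quiver.
   Context: Rings are associative with identity, not necessarily commutative. For a quiver $Q$ (possibly infinite, with vertices, arrows, source map $s$ and target map $t$), $(Q,R\text{-Mod})$ is the category of representations of $Q$ by left $R$-modules: a representation assigns a left $R$-module to each vertex and a homomorphism to each arrow; morphisms are natural transformations. $A_\infty^+$ is the quiver $\bullet\to\bullet\to\bullet\to\cdots$ with vertices $0,1,2,\dots$ and exactly one arrow $n\to n+1$ for each $n\ge0$. A quiver $Q$ is a source injective representation quiver if for every ring $R$ and every $\mathcal{X}\in(Q,R\text{-Mod})$: $\mathcal{X}$ is injective if and only if (i) $\mathcal{X}(v)$ is an injective $R$-module for every vertex $v$ and (ii) for every vertex $v$ the morphism $\mathcal{X}(v)\to\prod_{s(a)=v}\mathcal{X}(t(a))$ induced by the maps $\mathcal{X}(a)$ is a splitting epimorphism. *)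

(* Defs.v *)
From HB Require Import structures.
From mathcomp Require Import all_boot all_algebra.
From mathcomp Require Import boolp.

Set Implicit Arguments.
Unset Strict Implicit.
Unset Printing Implicit Defensive.

Import GRing.Theory.
Local Open Scope ring_scope.

(* Every type carries a choiceType structure by [boolp.gen_choiceMixin], so
   [pzRingType] and [lmodType R] impose no restriction on the rings (zero ring
   included) and left modules considered. *)

Definition injective_module (R : pzRingType) (E : lmodType R) : Prop :=
  forall (A B : lmodType R) (i : {linear A -> B}), injective i ->
  forall f : {linear A -> E}, exists g : {linear B -> E},
  forall x, g (i x) = f x.

Definition surjective (A B : Type) (f : A -> B) : Prop :=
  forall y, exists x, f x = y.

Definition split_epi (R : pzRingType) (M N : lmodType R)
    (f : {linear M -> N}) : Prop :=
  exists g : {linear N -> M}, forall y, f (g y) = y.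

Section Kernel.
Variables (R : pzRingType) (M N : lmodType R) (f : {linear M -> N}).

Definition kernel_pred : {pred M} := fun x => f x == 0.

Fact kernel_submod_closed : submod_closed kernel_pred.
Proof.
split=> [|a x y]; rewrite !unfold_in; first by rewrite linear0.
by move=> /eqP fx0 /eqP fy0; rewrite linearP fx0 fy0 scaler0 addr0.
Qed.

HB.instance Definition _ :=
  GRing.isSubmodClosed.Build R M kernel_pred kernel_submod_closed.

Record kernel := Kernel { kernel_val : M; _ : kernel_val \in kernel_pred }.

HB.instance Definition _ := [isSub for kernel_val].
HB.instance Definition _ := [Choice of kernel by <:].
HB.instance Definition _ := [SubChoice_isSubLmodule of kernel by <:].

End Kernel.

Section ProductModule.
Variables (R : pzRingType) (I : Type) (M : I -> lmodType R).

Definition prod_module : Type := forall i, M i.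

HB.instance Definition _ := Choice.on prod_module.

Implicit Types f g h : prod_module.

Definition prod_zero : prod_module := fun=> 0.
Definition prod_add f g : prod_module := fun i => f i + g i.
Definition prod_opp f : prod_module := fun i => - f i.
Definition prod_scale (a : R) f : prod_module := fun i => a *: f i.

Fact prod_addA : associative prod_add.
Proof. by move=> f g h; apply: functional_extensionality_dep => i; exact: addrA. Qed.
Fact prod_addC : commutative prod_add.
Proof. by move=> f g; apply: functional_extensionality_dep => i; exact: addrC. Qed.
Fact prod_add0 : left_id prod_zero prod_add.
Proof. by move=> f; apply: functional_extensionality_dep => i; exact: add0r. Qed.
Fact prod_addN : left_inverse prod_zero prod_opp prod_add.
Proof. by move=> f; apply: functional_extensionality_dep => i; exact: addNr. Qed.

HB.instance Definition _ := GRing.isZmodule.Build prod_module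
  prod_addA prod_addC prod_add0 prod_addN.

Fact prod_scaleA a b f : prod_scale a (prod_scale b f) = prod_scale (a * b) f.
Proof. by apply: functional_extensionality_dep => i; exact: scalerA. Qed.
Fact prod_scale1 : left_id 1 prod_scale.
Proof. by move=> f; apply: functional_extensionality_dep => i; exact: scale1r. Qed.
Fact prod_scaleDr : right_distributive prod_scale +%R.
Proof. by move=> a f g; apply: functional_extensionality_dep => i; exact: scalerDr. Qed.
Fact prod_scaleDl f : {morph prod_scale^~ f : a b / a + b}.
Proof. by move=> a b; apply: functional_extensionality_dep => i; exact: scalerDl. Qed.

HB.instance Definition _ := GRing.Zmodule_isLmodule.Build R prod_module
  prod_scaleA prod_scale1 prod_scaleDr prod_scaleDl.

Variables (N : lmodType R) (p : forall i, {linear N -> M i}).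

Definition prod_map (x : N) : prod_module := fun i => p i x.

Fact prod_map_linear : linear prod_map.
Proof.
by move=> a x y; apply: functional_extensionality_dep => i; exact: linearP.
Qed.

HB.instance Definition _ :=
  GRing.isLinear.Build R N prod_module *:%R prod_map prod_map_linear.

End ProductModule.

Record quiver := Quiver {
  vertex : Type;
  arrow : Type;
  source : arrow -> vertex;
  target : arrow -> vertex }.

Record rep (Q : quiver) (R : pzRingType) := Rep {
  rep_at :> vertex Q -> lmodType R;
  rep_map : forall a : arrow Q, {linear rep_at (source a) -> rep_at (target a)} }.

Record rep_hom (Q : quiver) (R : pzRingType) (X Y : rep Q R) := RepHom {
  hom_at :> forall v : vertex Q, {linear X v -> Y v};
  hom_natural : forall (a : arrow Q) (x : X (source a)),
    hom_at (target a) (rep_map X a x) = rep_map Y a (hom_at (source a) x) }.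

Definition rep_mono (Q : quiver) (R : pzRingType) (X Y : rep Q R)
    (i : rep_hom X Y) : Prop :=
  forall (Z : rep Q R) (g h : rep_hom Z X),
  (forall v z, i v (g v z) = i v (h v z)) -> forall v z, g v z = h v z.

Definition injective_rep (Q : quiver) (R : pzRingType) (E : rep Q R) : Prop :=
  forall (X Y : rep Q R) (i : rep_hom X Y), rep_mono i ->
  forall f : rep_hom X E, exists g : rep_hom Y E,
  forall v x, g v (i v x) = f v x.

Definition out_arrow (Q : quiver) (v : vertex Q) : Type :=
  {a : arrow Q | source a = v}.

Definition out_map (Q : quiver) (R : pzRingType) (X : rep Q R) (v : vertex Q)
    (p : out_arrow v) : {linear X v -> X (target (sval p))} :=
  match p with
  | exist a e =>
      match e in _ = w return {linear X w -> X (target a)} with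
      | erefl => rep_map X a
      end
  end.

Definition source_map (Q : quiver) (R : pzRingType) (X : rep Q R)
    (v : vertex Q) :
    {linear X v -> prod_module (fun p : out_arrow v => X (target (sval p)))} :=
  prod_map (@out_map Q R X v).

Definition source_injective_quiver (Q : quiver) : Prop :=
  forall (R : pzRingType) (X : rep Q R),
  injective_rep X <->
  (forall v, injective_module (X v)) /\
  (forall v, split_epi (source_map X v)).

(* The arrow [n] is the unique arrow from [n] to [n.+1]. *)
Definition A_infty_plus : quiver := Quiver (fun n : nat => n) S.

(* Main.v *)
Require Import Defs.
From mathcomp Require Import all_boot all_algebra.
From HB Require Import structures.
From mathcomp Require Import boolp.

(** Both characterizations come down to one: a chain [G] is injective if and
    only if every [G n] is an injective module and every map [G n -> G n.+1]
    is a split epimorphism ([injective_chainP]).  A vertex of the quiver emits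
    exactly one arrow, so the source map at [n] is the map [G n -> G n.+1] up
    to a product over one point ([split_source_mapP]); and for an injective
    module [M], an epimorphism out of [M] splits exactly when its kernel is
    injective ([split_epi_injective_kernelP]).

    An injective chain has these two properties by testing it on small
    monomorphisms.  A map of chains from a constant chain to [G] is a module
    map into [G 0], so [G 0] is injective.  Extending the identity of
    [G 1 -> G 2 -> ...] along the inclusion of [0 -> G 1 -> G 2 -> ...] into
    [G 1 = G 1 -> G 2 -> ...] gives a section of [G 0 -> G 1].  Deleting the
    vertex [0] preserves injectivity, which carries both facts to every
    vertex.

    Conversely, let [E] be a chain of injective modules with split maps, and
    let compatible partial linear maps from [X n] to [E n] be given.  A total
    map [g] on [X 0] has to be compatible with the data at all later vertices
    at once: whenever [x] in [X 0] is sent into the domain of the partial map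
    at [n], its value there dictates the image of [g x] in [E n].  The maps
    that respect these constraints up to [n] are built recursively: the map
    for [n] is corrected, through a section of [E 0 -> E n.+1], by the amount
    by which it misses the constraint at [n.+1].  That amount vanishes where
    a constraint up to [n] is in force, so the sequence is stationary at each
    constrained point.  Its limit is a partial linear map into the injective
    module [E 0], and any total extension of the limit will do
    ([extension_step]).  Adding to the data the values forced by [g] at the
    later vertices and deleting the vertex [0] gives a problem of the same
    kind, and iterating produces the extension of a map of chains vertex by
    vertex. *)

Set Implicit Arguments.
Unset Strict Implicit.
Unset Printing Implicit Defensive.

Import GRing.Theory.
Local Open Scope ring_scope.

(** * Partial linear maps *)

Lemma choice_dependent (I : Type) (T : I -> Type) (P : forall i, T i -> Prop) :
  (forall i, exists x, P i x) -> exists f : forall i, T i, forall i, P i (f i).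
Proof. by move=> H; exists (fun i => sval (cid (H i))) => i; exact: svalP. Qed.

Definition linear_of (R : pzRingType) (M N : lmodType R) (f : M -> N)
    (f_linear : linear f) : {linear M -> N} :=
  HB.pack f (GRing.isLinear.Build R M N *:%R f f_linear).

(** A linear map on a submodule of [M] is represented by its graph, so that
    domains can be enlarged without building new modules.  Being additive, a
    relation is single-valued as soon as it is so at [0]. *)
Record partial_linear (R : pzRingType) (M N : lmodType R)
    (P : M -> N -> Prop) : Prop := PartialLinear {
  partial0 : P 0 0;
  partialP : forall a x y x' y',
    P x y -> P x' y' -> P (a *: x + x') (a *: y + y');
  partial_fun0 : forall y, P 0 y -> y = 0 }.

Lemma partial_linear_functional (R : pzRingType) (M N : lmodType R)
    (P : M -> N -> Prop) :
  partial_linear P -> forall x y y', P x y -> P x y' -> y = y'.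
Proof.
move=> HP x y y' Pxy Pxy'; apply/eqP; rewrite -subr_eq0; apply/eqP.
apply: (partial_fun0 HP).
by have := partialP HP (-1) Pxy' Pxy; rewrite !scaleN1r addNr addrC.
Qed.

Section Graph.
Variables (R : pzRingType) (M N : lmodType R) (P : M -> N -> Prop).
Hypothesis HP : partial_linear P.

(** The proof that [P] is linear is an argument so that the module structure
    declared below can be found from the predicate alone. *)
Definition graph_pred of partial_linear P : {pred M * N} :=
  fun p => `[< P p.1 p.2 >].

Fact graph_submod_closed : submod_closed (graph_pred HP).
Proof.
split=> [|a [x y] [x' y']]; rewrite !unfold_in /=.
  by apply/asboolP; exact: partial0 HP.
by move=> /asboolP Pxy /asboolP Pxy'; apply/asboolP; exact: (partialP HP).
Qed.

HB.instance Definition _ :=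
  GRing.isSubmodClosed.Build R (M * N)%type (graph_pred HP) graph_submod_closed.

Record graph := Graph { graph_val : M * N; _ : graph_val \in graph_pred HP }.

HB.instance Definition _ := [isSub for graph_val].
HB.instance Definition _ := [Choice of graph by <:].
HB.instance Definition _ := [SubChoice_isSubLmodule of graph by <:].

Lemma graph_valP (p : graph) : P (graph_val p).1 (graph_val p).2.
Proof. by case: p => p /= /asboolP. Qed.

Lemma graph_val_linear : linear graph_val.
Proof. by move=> a p q; exact: (linearP (val : graph -> _)). Qed.

(** The graph is a module, and its first projection is injective because the
    relation is functional; a map extending the second projection along the
    first one extends the partial map. *)
Lemma extend_partial_linear :
  injective_module N ->
  exists g : {linear M -> N}, forall x y, P x y -> g x = y.
Proof.
move=> N_inj.
have fst_linear : linear (fun p : graph => (graph_val p).1).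
  by move=> a p q; rewrite graph_val_linear.
have snd_linear : linear (fun p : graph => (graph_val p).2).
  by move=> a p q; rewrite graph_val_linear.
have fst_inj : injective (linear_of fst_linear).
  move=> p q /= eq_pq; apply: val_inj => /=.
  have := graph_valP q; rewrite -eq_pq => Pq.
  have eq2 := partial_linear_functional HP (graph_valP p) Pq.
  by case: (graph_val p) (graph_val q) eq_pq eq2 => [u v] [u' v'] /= -> ->.
have [g gP] := N_inj _ _ _ fst_inj (linear_of snd_linear).
exists g => x y Pxy.
have xyP : (x, y) \in graph_pred HP by apply/asboolP.
exact: gP (Graph xyP).
Qed.

End Graph.

(** * Split epimorphisms and injective kernels *)

Section KernelMaps.
Variables (R : pzRingType) (M N : lmodType R) (f : {linear M -> N}).

Lemma kernel_val_linear : linear (@kernel_val R M N f).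
Proof. by move=> a p q; exact: (linearP (val : kernel f -> _)). Qed.

Definition kernel_incl : {linear kernel f -> M} := linear_of kernel_val_linear.

Lemma kernel_valP (k : kernel f) : f (kernel_val k) = 0.
Proof. by case: k => k /= /eqP. Qed.

Lemma kernel_incl_inj : injective kernel_incl.
Proof. by move=> k k' eq_k; apply: val_inj. Qed.

Lemma to_kernel (L : lmodType R) (u : {linear L -> M}) :
  (forall x, f (u x) = 0) ->
  exists k : {linear L -> kernel f}, forall x, kernel_incl (k x) = u x.
Proof.
move=> fu0.
have uP x : u x \in kernel_pred f by apply/eqP.
have k_linear : linear (fun x => Kernel (uP x)).
  move=> a x y; apply: kernel_incl_inj; symmetry.
  by apply: etrans (kernel_val_linear _ _ _) _; rewrite /= linearP.
by exists (linear_of k_linear).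
Qed.

(** With [s] a section of [f], the map [x |-> x - s (f x)] retracts [M] onto
    the kernel, and a retract of an injective module is injective. *)
Lemma split_epi_kernel_injective :
  injective_module M -> split_epi f -> injective_module (kernel f).
Proof.
move=> M_inj [s sK] A B i i_inj h.
have [g gP] := M_inj _ _ _ i_inj (kernel_incl \o h).
have p_linear : linear (fun x => g x - s (f (g x))).
  by move=> a x y; rewrite !linearP addrACA -scalerDr.
have [|k kP] := to_kernel (u := linear_of p_linear).
  by move=> x; rewrite /= linearB sK subrr.
exists k => x; apply: kernel_incl_inj; rewrite kP /= gP /=.
by rewrite kernel_valP linear0 subr0.
Qed.

(** An injective kernel has a retraction [r], and [q x := x - r x] kills the
    kernel without changing [f x]; hence [q x] depends linearly on [f x]
    only, and applying [q] to any preimages gives a linear section. *)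
Lemma surjective_split_epi :
  surjective f -> injective_module (kernel f) -> split_epi f.
Proof.
move=> f_surj K_inj.
have [r rP] := K_inj _ _ _ kernel_incl_inj idfun.
pose q x := x - kernel_incl (r x).
have q_linear : linear q.
  by move=> a x y; rewrite /q !linearP addrACA -scalerDr.
have f_q x : f (q x) = f x by rewrite linearB kernel_valP subr0.
have q_eq x y : f x = f y -> q x = q y.
  move=> eq_f; have kP : x - y \in kernel_pred f.
    by rewrite unfold_in linearB eq_f subrr.
  have /eqP := congr1 kernel_incl (rP (Kernel kP)).
  rewrite [X in _ == X]/= eq_sym -subr_eq0 => /eqP q0.
  have -> : x = 1 *: (x - y) + y by rewrite scale1r subrK.
  by rewrite q_linear scale1r [q (x - y)]q0 add0r.
have [pre preP] := choice f_surj.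
have s_linear : linear (q \o pre).
  by move=> a x y; rewrite /= -q_linear; apply: q_eq; rewrite linearP !preP.
by exists (linear_of s_linear) => y; rewrite /= f_q preP.
Qed.

Lemma split_epi_injective_kernelP :
  injective_module M ->
  split_epi f <-> surjective f /\ injective_module (kernel f).
Proof.
move=> M_inj; split=> [f_split | [f_surj K_inj]].
  split; last exact: split_epi_kernel_injective.
  by case: f_split => s sK y; exists (s y).
exact: surjective_split_epi.
Qed.

End KernelMaps.

(** * Monomorphisms of representations *)

Section Mono.
Variables (Q : quiver) (R : pzRingType) (X Y : rep Q R) (i : rep_hom X Y).

Lemma rep_mono_of_injective : (forall v, injective (i v)) -> rep_mono i.
Proof. by move=> i_inj Z g h eq_ig v z; apply: i_inj; exact: eq_ig. Qed.

(** The kernels of the maps [i v] form a subrepresentation of [X]; its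
    inclusion and its zero map agree after [i], hence agree. *)
Lemma rep_mono_injective : rep_mono i -> forall v, injective (i v).
Proof.
move=> i_mono.
have restrict a : exists d : {linear kernel (i (source a)) ->
    kernel (i (target a))},
    forall k, kernel_incl (i (target a)) (d k) = rep_map X a (kernel_incl _ k).
  apply: (to_kernel (u := rep_map X a \o kernel_incl (i (source a)))).
  by move=> k; rewrite /= hom_natural kernel_valP linear0.
have [d dP] := choice_dependent restrict.
pose K := @Rep Q R (fun v => kernel (i v) : lmodType R) d.
pose incl := @RepHom Q R K X (fun v => kernel_incl (i v)) dP.
have zero_natural a (k : K (source a)) :
    (\0 : {linear K (target a) -> X (target a)}) (rep_map K a k) =
    rep_map X a ((\0 : {linear K (source a) -> X (source a)}) k).
  by rewrite /= linear0.
pose zero := @RepHom Q R K X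
  (fun v => (\0 : {linear K v -> X v})) zero_natural.
have incl0 : forall v (k : K v), incl v k = zero v k.
  by apply: i_mono => v k /=; rewrite kernel_valP linear0.
move=> v x y eq_xy; apply/eqP; rewrite -subr_eq0; apply/eqP.
have kP : x - y \in kernel_pred (i v) by rewrite unfold_in linearB eq_xy subrr.
exact: incl0 v (Kernel kP).
Qed.

End Mono.

(** * Chains of modules *)

Section Chains.
Variable R : pzRingType.
Notation A := A_infty_plus.
Notation chain := (rep A R).

Definition shift (G : chain) : chain :=
  @Rep A R (fun n => G n.+1) (fun n => rep_map G n.+1).

Fixpoint from0 (G : chain) (n : nat) : {linear G 0%N -> G n} :=
  match n with
  | 0 => idfun
  | m.+1 => rep_map G m \o from0 G m
  end.

Definition prepend_at (M : lmodType R) (G : chain) (n : nat) : lmodType R :=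
  match n with 0 => M | m.+1 => G m end.

Definition prepend (M : lmodType R) (G : chain) (d : {linear M -> G 0%N}) :
    chain :=
  @Rep A R (prepend_at M G)
    (fun n => match n return {linear prepend_at M G n -> G n} with
     | 0 => d
     | m.+1 => rep_map G m
     end).

Section PrependHom.
Variables (M : lmodType R) (X G : chain) (d : {linear M -> X 0%N}).
Variables (h0 : {linear M -> G 0%N}) (h : forall n, {linear X n -> G n.+1}).
Hypothesis h0P : forall x, h 0 (d x) = rep_map G 0 (h0 x).
Hypothesis hP : forall n x, h n.+1 (rep_map X n x) = rep_map G n.+1 (h n x).

Definition prepend_hom_at n : {linear prepend d n -> G n} :=
  match n return {linear prepend d n -> G n} with
  | 0 => h0
  | m.+1 => h m
  end.

Fact prepend_hom_natural n (x : prepend d n) :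
  prepend_hom_at n.+1 (rep_map (prepend d) n x) =
  rep_map G n (prepend_hom_at n x).
Proof. by case: n x => [|n] x; [exact: h0P | exact: hP]. Qed.

Definition prepend_hom : rep_hom (prepend d) G :=
  @RepHom A R (prepend d) G prepend_hom_at prepend_hom_natural.

End PrependHom.

Definition zero_module : lmodType R := prod_module (fun _ : False => R^o).

Lemma zero_module_eq (x y : zero_module) : x = y.
Proof. by apply: functional_extensionality_dep; case. Qed.

Definition from_zero (M : lmodType R) : {linear zero_module -> M} := \0.

Lemma from_zero_inj (M : lmodType R) : injective (from_zero M).
Proof. by move=> x y _; exact: zero_module_eq. Qed.

(** * Injective chains have injective vertices and split maps *)

Section InjectiveChain.
Variable G : chain.
Hypothesis G_inj : injective_rep G.

(** Putting a zero module in front is left adjoint to [shift] and preserves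
    monomorphisms. *)
Lemma shift_injective : injective_rep (shift G).
Proof.
move=> X Y i /rep_mono_injective i_inj f.
pose X' := prepend (from_zero (X 0%N)).
pose Y' := prepend (from_zero (Y 0%N)).
have i0P x : i 0%N (from_zero (X 0%N) x) = rep_map Y' 0 (idfun x).
  by rewrite /= linear0.
pose i' := @prepend_hom zero_module X Y' (from_zero _) idfun i i0P
  (hom_natural i).
have f0P x : f 0%N (from_zero (X 0%N) x) = rep_map G 0 (from_zero _ x).
  by rewrite /= !linear0.
pose f' := @prepend_hom zero_module X G (from_zero _) (from_zero _) f f0P
  (hom_natural f).
have i'_mono : rep_mono i'.
  apply: rep_mono_of_injective => -[|n]; last exact: i_inj.
  by move=> x y _; exact: zero_module_eq.
have [g gP] := G_inj i'_mono f'.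
exists (@RepHom A R Y (shift G) (fun n => g n.+1)
  (fun n => @hom_natural A R Y' G g n.+1)).
by move=> n; exact: gP n.+1.
Qed.

Definition constant (M : lmodType R) : chain :=
  @Rep A R (fun=> M) (fun=> idfun).

(** The constant chain is left adjoint to evaluation at the vertex [0]. *)
Lemma injective_chain_at0 : injective_module (G 0%N).
Proof.
move=> M N i i_inj f.
pose i' := @RepHom A R (constant M) (constant N) (fun=> i) (fun _ _ => erefl).
pose f' := @RepHom A R (constant M) G (fun n => from0 G n \o f)
  (fun _ _ => erefl).
have i'_mono : rep_mono i' by exact: rep_mono_of_injective.
have [g gP] := G_inj i'_mono f'.
by exists (g 0%N) => x; exact: gP 0%N x.
Qed.

(** Extending the identity of [G 1 -> G 2 -> ...] from [0 -> G 1 -> ...] to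
    [G 1 = G 1 -> ...] forces the component at [0] to be a section. *)
Lemma injective_chain_split0 : split_epi (rep_map G 0).
Proof.
pose Y := @prepend (G 1%N) (shift G) idfun.
have iP (x : zero_module) :
    (idfun : {linear G 1%N -> G 1%N}) (from_zero _ x) =
    rep_map Y 0 (from_zero _ x).
  by [].
pose i := @prepend_hom zero_module (shift G) Y (from_zero _)
  (from_zero _) (fun=> idfun) iP (fun _ _ => erefl).
have fP (x : zero_module) :
    (idfun : {linear G 1%N -> G 1%N}) (from_zero _ x) =
    rep_map G 0 (from_zero _ x).
  by rewrite /= linear0.
pose f := @prepend_hom zero_module (shift G) G (from_zero _)
  (from_zero _) (fun=> idfun) fP (fun _ _ => erefl).
have i_mono : rep_mono i.
  apply: rep_mono_of_injective => -[|n]; last by move=> x y.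
  exact: from_zero_inj.
have [g gP] := G_inj i_mono f.
exists (g 0%N) => y.
have := @hom_natural A R Y G g 0%N y => /= <-.
exact: gP 1%N y.
Qed.

End InjectiveChain.

Lemma injective_chain_components (n : nat) (G : chain) :
  injective_rep G -> injective_module (G n) /\ split_epi (rep_map G n).
Proof.
elim: n G => [|n IHn] G G_inj.
  by split; [exact: injective_chain_at0 | exact: injective_chain_split0].
exact: IHn (shift G) (shift_injective G_inj).
Qed.


(** * Extending partial maps of chains at the first vertex *)

Section ExtensionStep.
Variables (X E : chain) (P : forall n, X n -> E n -> Prop).
Hypothesis E_inj : forall n, injective_module (E n).
Hypothesis E_split : forall n, split_epi (rep_map E n).
Hypothesis P_linear : forall n, partial_linear (@P n).
Hypothesis P_stable : forall n x y,
  @P n x y -> @P n.+1 (rep_map X n x) (rep_map E n y).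

Lemma from0_split_epi n : split_epi (from0 E n).
Proof.
elim: n => [|n [s sK]]; first by exists idfun.
have [t tK] := E_split n; exists (s \o t) => y.
by rewrite /= sK; exact: tK.
Qed.

(** The partial maps [P n] constrain a map out of [X 0] through the whole
    chain, and [g] meets all these constraints.  Corrections are made through
    linear sections, hence are zero wherever the discrepancy is; so those made
    for a late vertex leave the points constrained earlier alone. *)
Lemma extension_step : exists g : {linear X 0%N -> E 0%N},
  forall n x y, @P n (from0 X n x) y -> from0 E n (g x) = y.
Proof.
have [c cP] := choice_dependent
  (fun n => extend_partial_linear (P_linear n) (@E_inj n)).
have [s sK] := choice_dependent from0_split_epi.
(* [c n] extends [P n] to all of [X n] and [s n] is a section of
   [E 0 -> E n]; [lift n] is [c n] lifted through [E 0 -> E n], chosen so as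
   to agree with [lift n.-1] where the constraint at [n.-1] is in force. *)
pose fix lift n : X 0%N -> E 0%N :=
  if n isn't m.+1 then c 0%N
  else fun x => lift m x
    + s m.+1 (c m.+1 (from0 X m.+1 x) - from0 E m.+1 (lift m x)).
have liftS n x : lift n.+1 x = lift n x
    + s n.+1 (c n.+1 (from0 X n.+1 x) - from0 E n.+1 (lift n x)) by [].
have lift_linear n : linear (lift n).
  elim: n => [|n IHn] a x y; first exact: linearP.
  rewrite !liftS IHn; move: (lift n x) (lift n y) => u v.
  by rewrite !linearP addrACA -scalerDr linearP addrACA -scalerDr.
have lift_over n x : from0 E n (lift n x) = c n (from0 X n x).
  case: n => [|n] //.
  by rewrite liftS linearD sK addrC subrK.
(* [D n] is the preimage in [X 0] of the domain of [P n]. *)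
pose D n x := exists y, @P n (from0 X n x) y.
have D_step n x : D n x -> D n.+1 x.
  by case=> y Pxy; exists (rep_map E n y); exact: P_stable.
have lift_step n x : D n x -> lift n.+1 x = lift n x.
  case=> y Pxy; rewrite liftS.
  (* By stability of [P], both sides are the image of the value prescribed
     at [n], so the correction vanishes at [x]. *)
  have -> : c n.+1 (from0 X n.+1 x) = from0 E n.+1 (lift n x).
    rewrite (cP _ _ _ (P_stable Pxy)).
    by rewrite [RHS]/= lift_over (cP _ _ _ Pxy).
  by rewrite subrr linear0 addr0.
have D_le n k x : D n x -> D (k + n)%N x.
  by move=> Dx; elim: k => // k IHk; exact: D_step.
have lift_le n k x : D n x -> lift (k + n)%N x = lift n x.
  by move=> Dx; elim: k => // k IHk; rewrite addSn lift_step //; exact: D_le.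
(* The limit of the [lift n], defined on the union of the [D n]. *)
pose L x y := exists n, D n x /\ y = lift n x.
have L_linear : partial_linear L.
  split=> [|a x y x' y' [n [Dx ->]] [m [Dx' ->]]|y [n [D0 ->]]].
  - exists 0%N; split; first by exists 0; rewrite linear0; exact: partial0.
    by rewrite /= linear0.
  - exists (m + n)%N; split; last first.
      by rewrite lift_linear lift_le // addnC lift_le.
    have [z Pz] := D_le n m x Dx; have := D_le m n x' Dx'.
    rewrite addnC => -[z' Pz']; exists (a *: z + z').
    by rewrite linearP; exact: partialP.
  - by have := lift_linear n 1 0 0; rewrite !scale1r !addr0 => /eqP;
      rewrite eq_sym -subr_eq0 addrK => /eqP.
have [g gP] := extend_partial_linear L_linear (@E_inj 0%N).
exists g => n x y Pxy; have Dx : D n x by exists y.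
by rewrite (gP x (lift n x)) ?lift_over; [exact: cP | exists n].
Qed.

(** * Solving extension problems vertex by vertex *)

Section Pushforward.
Variable g : {linear X 0%N -> E 0%N}.
Hypothesis gP : forall n x y, @P n (from0 X n x) y -> from0 E n (g x) = y.

(** The prescribed partial map at [n], enlarged by the values that
    naturality forces on the image of [X 0] once [g] is chosen. *)
Definition pushforward n (x : X n) (y : E n) : Prop :=
  exists u v z, [/\ P u v, x = u + from0 X n z & y = v + from0 E n (g z)].

(** Single-valuedness is where the compatibility of [g] is used: if
    [u + from0 X n z] is zero, then [u] is the image of [- z], so its
    prescribed value is the image of [g (- z)]. *)
Lemma pushforward_linear n : partial_linear (@pushforward n).
Proof.
split.
- exists 0, 0, 0; split; first exact: partial0.
    by rewrite linear0 addr0.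
  by rewrite !linear0 addr0.
- move=> a _ _ _ _ [u [v [z [Puv -> ->]]]] [u' [v' [z' [Puv' -> ->]]]].
  exists (a *: u + u'), (a *: v + v'), (a *: z + z').
  by split; [exact: partialP | |]; rewrite !linearP scalerDr addrACA.
- move=> _ [u [v [z [Puv eq_u ->]]]].
  have := gP (x := - z) (y := v); rewrite !linearN => <-; first by rewrite addNr.
  by rewrite -[- _](addrK (from0 X n z)) addNr eq_u addrK.
Qed.

Lemma pushforward_stable n x y :
  pushforward x y -> @pushforward n.+1 (rep_map X n x) (rep_map E n y).
Proof.
move=> [u [v [z [Puv -> ->]]]].
exists (rep_map X n u), (rep_map E n v), z.
by split; [exact: P_stable | |]; rewrite linearD.
Qed.

Lemma pushforward_given n x y : @P n x y -> pushforward x y.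
Proof. by move=> Pxy; exists x, y, 0; rewrite !linear0 !addr0. Qed.

Lemma pushforward_step x :
  @pushforward 1 (rep_map X 0 x) (rep_map E 0 (g x)).
Proof. by exists 0, 0, x; rewrite !add0r; split=> //; exact: partial0. Qed.

End Pushforward.
End ExtensionStep.

(** Keeping the chains in the state of the recursion makes deletion of the
    first vertex an operation on problems, so the map at vertex [n.+1] is, by
    conversion, the map at vertex [n] of another problem. *)
Record extension_problem := ExtensionProblem {
  dom : chain;
  cod : chain;
  prescribed : forall n, dom n -> cod n -> Prop;
  cod_injective : forall n, injective_module (cod n);
  cod_split : forall n, split_epi (rep_map cod n);
  prescribed_linear : forall n, partial_linear (@prescribed n);
  prescribed_stable : forall n x y, @prescribed n x y ->
    @prescribed n.+1 (rep_map dom n x) (rep_map cod n y) }.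

Definition first_map_spec (p : extension_problem) :=
  cid (extension_step (@cod_injective p) (@cod_split p)
    (@prescribed_linear p) (@prescribed_stable p)).

Definition first_map p : {linear dom p 0%N -> cod p 0%N} :=
  sval (first_map_spec p).

Lemma first_map_compatible p n x y :
  prescribed (from0 (dom p) n x) y -> from0 (cod p) n (first_map p x) = y.
Proof. exact: (svalP (first_map_spec p)). Qed.

Definition next_problem (p : extension_problem) : extension_problem :=
  @ExtensionProblem (shift (dom p)) (shift (cod p))
    (fun n => pushforward (@prescribed p) (first_map p) (n := n.+1))
    (fun n => @cod_injective p n.+1)
    (fun n => @cod_split p n.+1)
    (fun n => pushforward_linear (@prescribed_linear p)
       (@first_map_compatible p) n.+1)
    (fun n => @pushforward_stable _ _ _ (@prescribed_stable p) _ n.+1).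

Fixpoint solution n (p : extension_problem) : {linear dom p n -> cod p n} :=
  match n return {linear dom p n -> cod p n} with
  | 0 => first_map p
  | m.+1 => solution m (next_problem p)
  end.

Lemma solution_prescribed n p x y : prescribed x y -> solution n p x = y.
Proof.
elim: n p x y => [|n IHn] p x y Pxy.
  exact: (first_map_compatible (n := 0%N) Pxy).
by apply: (IHn (next_problem p)); exact: pushforward_given.
Qed.

(** At the first vertex, the square commutes because the values of
    [first_map] were pushed forward into the next problem. *)
Lemma solution_natural n p x :
  solution n.+1 p (rep_map (dom p) n x) = rep_map (cod p) n (solution n p x).
Proof.
elim: n p x => [|n IHn] p x; last exact: IHn (next_problem p) x.
apply: (first_map_compatible (p := next_problem p) (n := 0%N)).
exact/pushforward_step/prescribed_linear.
Qed.

(** A map of chains defined on a subobject is a coherent family of partial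
    linear maps, so it starts an extension problem. *)
Lemma split_chain_injective (E : chain) :
  (forall n, injective_module (E n)) ->
  (forall n, split_epi (rep_map E n)) -> injective_rep E.
Proof.
move=> E_inj E_split X Y i /rep_mono_injective i_inj f.
pose P n y e := exists x, y = i n x /\ e = f n x.
have P_linear n : partial_linear (@P n).
  split=> [|a _ _ _ _ [x [-> ->]] [x' [-> ->]]|_ [x [/esym ix0 ->]]].
  - by exists 0; rewrite !linear0.
  - by exists (a *: x + x'); rewrite !linearP.
  - by rewrite -[RHS](linear0 (f n)); congr (f n _); apply: i_inj;
      rewrite ix0 linear0.
have P_stable n y e : @P n y e -> @P n.+1 (rep_map Y n y) (rep_map E n e).
  case=> x [-> ->]; exists (rep_map X n x).
  by split; [rewrite -(hom_natural i) | rewrite -(hom_natural f)].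
pose p := ExtensionProblem E_inj E_split P_linear P_stable.
exists (@RepHom A R Y E (fun n => solution n p) (fun n => @solution_natural n p)).
by move=> n x; apply: (@solution_prescribed n p); exists x.
Qed.

(** * The two characterizations *)

Lemma injective_chainP (E : chain) :
  injective_rep E <->
  (forall n, injective_module (E n)) /\ (forall n, split_epi (rep_map E n)).
Proof.
split=> [E_inj | [E_inj E_split]]; last exact: split_chain_injective.
by split=> n; have [] := injective_chain_components n E_inj.
Qed.

Lemma out_arrow_eq n (p : @out_arrow A n) : p = exist _ n erefl.
Proof. by case: p => a e; case: _ / e. Qed.

(** The inverse of the evaluation of the product over [out_arrow n] at its
    only element needs [G n.+1] carried along the equation between [n] and the
    source of the arrow. *)
Definition transport_target (G : chain) n (p : @out_arrow A n) :
    {linear G n.+1 -> G (target (sval p))} :=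
  match p with
  | exist a e =>
      match e in _ = m return {linear G m.+1 -> G a.+1} with
      | erefl => idfun
      end
  end.

Lemma split_source_mapP (G : chain) n :
  split_epi (@source_map A R G n) <-> split_epi (rep_map G n).
Proof.
pose here : @out_arrow A n := exist _ n erefl.
pose W := prod_module (fun p : @out_arrow A n => G (target (sval p))).
split=> -[s sK].
- have u_linear : linear (fun y : G n.+1 =>
      prod_map (@transport_target G n) y).
    by move=> a x y; rewrite linearP.
  exists (s \o linear_of u_linear) => y.
  exact: (congr1 (fun w : W => w here) (sK (linear_of u_linear y))).
- have u_linear : linear (fun w : W => w here).
    by [].
  exists (s \o linear_of u_linear) => w.
  apply: functional_extensionality_dep => p.
  by rewrite (out_arrow_eq p); exact: sK.
Qed.

End Chains.

Theorem theorem5p3 :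
  (forall (R : pzRingType) (G : rep A_infty_plus R),
     injective_rep G <->
     (forall n : nat, injective_module (G n)) /\
     (forall n : nat,
        surjective (rep_map G n) /\ injective_module (kernel (rep_map G n)))) /\
  source_injective_quiver A_infty_plus.
Proof.
split=> R G; apply: iff_trans (injective_chainP G) _.
- split=> -[G_inj H]; split=> // n.
    by apply/split_epi_injective_kernelP; [exact: G_inj | exact: H].
  by apply/split_epi_injective_kernelP; [exact: G_inj | exact: H].
- by split=> -[G_inj H]; split=> // n; apply/split_source_mapP; exact: H.
Qed.
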